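(* Let $d$ be a positive integer and fix a $d$-RSK growth diagram on a Young diagram $F$. Let $p$ be a lattice point of $F$ and let $\lambda$ be the partition assigned to $p$. Then $\ell(\lambda)=\min(d,K)$, where $K$ is the length of the longest se-chain consisting of cells of $\mathrm{Rect}_p$. Moreover, let $T$ be the $d$-semistandard $w$-oscillating tableau formed by the partitions on the outer boundary of $F$ (listed from the point on the positive $x$-axis, $w$ the type sequence of the outer boundary). Then the length of the longest NE-chain in $F$ equals $\mathrm{MCW}_d(T)$.
   Context: Partitions: finite weakly decreasing sequences of positive integers, with $\lambda_i=0$ for $i>\ell(\lambda)$; a $d$-partition has $\ell(\lambda)\le d$. Interlacing: $\alpha\prec\beta$ (also $\beta\succ\alpha$) means $\beta_1\ge\alpha_1\ge\beta_2\ge\alpha_2\ge\cdots$. Young diagrams lie in the first quadrant, made of unit cells with integer corners, left-justified, row 1 adjacent to the $x$-axis; lattice points are corners of cells. For a lattice point $p=(x,y)$, $\mathrm{Rect}_p$ is the rectangular Young diagram $[0,x]\times[0,y]$. A filling assigns nonnegative integer entries to cells. A NE-chain is a sequence of cells with nonzero entries each weakly above and weakly to the right of the previous one; its length is the sum of the entries. A se-chain is a sequence of cells with nonzero entries each strictly below and strictly to the right of the previous; its length is the number of cells. The outer boundary is the lattice path of unit up/left steps from the positive $x$-axis to the positive $y$-axis; its type sequence records `$+$' for up, `$-$' for left. A $d$-RSK growth diagram on $F$: a filling plus a partition at each lattice point, with $\emptyset$ at all points on the axes, and every cell (entry $m$; bottom-left, top-left, bottom-right, top-right corners $\kappa,\mu,\nu,\rho$)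 satisfying: all four are $d$-partitions, $\mu\succ\kappa\prec\nu$, $\mu\prec\rho\succ\nu$, $m=0$ or $\kappa_d=0$, $\rho_1+\kappa_d=m+\min(\mu_d,\nu_d)+\max(\mu_1,\nu_1)$, and $\rho_i+\kappa_{i-1}=\min(\mu_{i-1},\nu_{i-1})+\max(\mu_i,\nu_i)$ for $2\le i\le d$. A $d$-semistandard $w$-oscillating tableau ($w=w_1\cdots w_r$) is a sequence of $d$-partitions $\emptyset=\lambda^{(0)},\ldots,\lambda^{(r)}=\emptyset$ with $\lambda^{(i-1)}\prec\lambda^{(i)}$ if $w_i=+$ and $\lambda^{(i-1)}\succ\lambda^{(i)}$ if $w_i=-$. For $d$-partitions with $\alpha\prec\beta$ set $\mathrm{MCW}_d(\alpha,\beta)=\mathrm{MCW}_d(\beta,\alpha)=\beta_1-\alpha_d$. The minimum cylindric width is $\mathrm{MCW}_d(T)=\max_{1\le i\le r}\mathrm{MCW}_d(\lambda^{(i-1)},\lambda^{(i)})$ (the smallest $L$ such that all consecutive relations hold with the additional inequality that the larger partition's first part minus the smaller partition's $d$-th part is at most $L$). *)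

(* Defs.v *)
From mathcomp Require Import all_boot.
Set Warnings "-notation-overridden".
Set Implicit Arguments. Unset Strict Implicit. Unset Printing Implicit Defensive.

(* Partitions are represented as finite weakly decreasing seqs of positive
   integers; the i-th part (i >= 1) is [part l i], 0 beyond the length. *)
Definition part (l : seq nat) (i : nat) : nat := nth 0 l i.-1.

Definition is_partition (l : seq nat) : bool :=
  sorted geq l && all (fun x => 0 < x) l.

Definition is_dpart (d : nat) (l : seq nat) : bool :=
  is_partition l && (size l <= d).

Definition interlace (a b : seq nat) : Prop :=
  forall i, 0 < i -> part b i.+1 <= part a i <= part b i.

(* Young diagram with row lengths sh (row 1 = bottom row, adjacent to the
   x-axis).  Cell (a,b) is the unit square [a,a+1]x[b,b+1]. *)
Definition in_F (sh : seq nat) (a b : nat) : bool := (b < size sh) && (a < nth 0 sh b).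

(* lattice points of F: corners of cells of F (and the origin, for F empty) *)
Definition lattice_pt (sh : seq nat) (x y : nat) : Prop :=
  (x = 0 /\ y = 0) \/
  exists a b, [/\ in_F sh a b, a <= x <= a.+1 & b <= y <= b.+1].

Definition growth_diagram (d : nat) (sh : seq nat)
    (f : nat -> nat -> nat) (P : nat -> nat -> seq nat) : Prop :=
  (forall x y, lattice_pt sh x y -> (x = 0 \/ y = 0) -> P x y = [::]) /\
  (forall a b, in_F sh a b ->
     let m := f a b in
     let ka := P a b in let mu := P a b.+1 in
     let nu := P a.+1 b in let rho := P a.+1 b.+1 in
     [/\ is_dpart d ka /\ is_dpart d mu /\ is_dpart d nu /\ is_dpart d rho,
         (interlace ka mu /\ interlace ka nu) /\
         (interlace mu rho /\ interlace nu rho),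
         (m == 0) || (part ka d == 0),
         part rho 1 + part ka d =
           m + minn (part mu d) (part nu d) + maxn (part mu 1) (part nu 1) &
         forall i, 2 <= i <= d ->
           part rho i + part ka i.-1 =
             minn (part mu i.-1) (part nu i.-1) + maxn (part mu i) (part nu i)]).

Definition ne_rel (c1 c2 : nat * nat) : bool :=
  [&& c1.1 <= c2.1, c1.2 <= c2.2 & c1 != c2].

Definition ne_chain (sh : seq nat) (f : nat -> nat -> nat) (s : seq (nat * nat)) : bool :=
  all (fun c => in_F sh c.1 c.2 && (f c.1 c.2 != 0)) s && sorted ne_rel s.

Definition ne_length (f : nat -> nat -> nat) (s : seq (nat * nat)) : nat :=
  \sum_(c <- s) f c.1 c.2.

Definition se_rel (c1 c2 : nat * nat) : bool := (c1.1 < c2.1) && (c2.2 < c1.2).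

Definition se_chain_rect (x y : nat) (f : nat -> nat -> nat) (s : seq (nat * nat)) : bool :=
  all (fun c => [&& c.1 < x, c.2 < y & f c.1 c.2 != 0]) s && sorted se_rel s.

Definition is_max_over (T : Type) (P : T -> Prop) (g : T -> nat) (K : nat) : Prop :=
  (exists s, P s /\ g s = K) /\ (forall s, P s -> g s <= K).

(* Outer boundary: type sequence (true = '+' = up step, false = '-' = left step)
   starting from the point (sh_1, 0) on the x-axis. *)
Fixpoint bsteps (sh : seq nat) : seq bool :=
  match sh with
  | [::] => [::]
  | r :: t => true :: nseq (r - head 0 t) false ++ bsteps t
  end.

Definition bstep (p : nat * nat) (up : bool) : nat * nat :=
  if up then (p.1, p.2.+1) else (p.1.-1, p.2).

Fixpoint bpoints (p : nat * nat) (w : seq bool) : seq (nat * nat) :=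
  p :: match w with [::] => [::] | b :: w' => bpoints (bstep p b) w' end.

Definition boundary_word (sh : seq nat) : seq bool := bsteps sh.
Definition boundary_points (sh : seq nat) : seq (nat * nat) :=
  bpoints (head 0 sh, 0) (bsteps sh).

Definition osc_tableau (d : nat) (w : seq bool) (T : seq (seq nat)) : Prop :=
  size T = (size w).+1 /\ nth [::] T 0 = [::] /\ last [::] T = [::] /\
  (forall i, i < size T -> is_dpart d (nth [::] T i)) /\
  (forall i, i < size w ->
     if nth false w i then interlace (nth [::] T i) (nth [::] T i.+1)
     else interlace (nth [::] T i.+1) (nth [::] T i)).

Definition MCW2 (d : nat) (small big : seq nat) : nat := part big 1 - part small d.

Definition MCW (d : nat) (w : seq bool) (T : seq (seq nat)) : nat :=
  \max_(i < size w)
    (if nth false w i then MCW2 d (nth [::] T i) (nth [::] T i.+1)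
     else MCW2 d (nth [::] T i.+1) (nth [::] T i)).

(* Main.v *)
Require Import Defs.
From mathcomp Require Import all_boot.
From mathcomp Require Import zify.
Set Implicit Arguments. Unset Strict Implicit. Unset Printing Implicit Defensive.

(** Peeling the parts off one at a time reduces the growth rules to last passage
    recursions rho_i = (inflow) + max(mu_i, nu_i), where for i >= 2 the inflow
    min(mu_{i-1}, nu_{i-1}) - kappa_{i-1} is what row i-1 bumps out, and for
    i = 1 it is m plus the amount bumped out of row d.  Passing from a filling
    to the one bumped out of it shortens the longest se-chain by exactly one
    (Viennot's shadow lines).  Below the lattice points with lambda_d = 0 nothing
    is bumped out of row d, so the diagram is ordinary RSK there and lambda_i > 0
    iff there is a se-chain of length i; a minimal point with lambda_d > 0
    already sees a se-chain of length d.

    For NE-chains, put on each edge the weight (larger partition)_1 -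
    (smaller partition)_d.  In each cell
      max(top, right) = m + max(bottom, left),
    so the weights only grow towards the outer boundary, and they grow strictly
    only when m > 0.  In that case kappa_d = 0, the diagram is ordinary RSK below
    mu and nu, and max(top, right) is the length of a longest NE-chain ending
    in the cell. *)

(** * Last passage recursions and shadow lines *)

(** The recursion for the largest total weight [g x y] of an up-right path of cells weighted by [M].
    The bounds [X] and [Y] keep it to rectangles inside the Young diagram, where the growth rules
    hold. *)
Definition last_passage (X Y : nat) (M g : nat -> nat -> nat) : Prop :=
  [/\ forall x, x <= X -> g x 0 = 0,
      forall y, y <= Y -> g 0 y = 0 &
      forall a b, a < X -> b < Y ->
        g a.+1 b.+1 = M a b + maxn (g a b.+1) (g a.+1 b)].

(** For a last passage function the subtraction is not truncated, and the nonzero cells are the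
    corners where Viennot's shadow lines turn. *)
Definition bump (g : nat -> nat -> nat) (a b : nat) : nat :=
  minn (g a b.+1) (g a.+1 b) - g a b.

Definition has_se (X Y : nat) (M : nat -> nat -> nat) (k : nat) : Prop :=
  exists2 s, se_chain_rect X Y M s & size s = k.

Section LastPassage.

Variables (X Y : nat) (M g : nat -> nat -> nat).
Hypothesis lp : last_passage X Y M g.

Lemma last_passage_sub x y :
  x <= X -> y <= Y -> last_passage x y M g.
Proof.
case: lp => g0 g1 rule xX yY; split=> [x' ?|y' ?|a b ? ?].
- by apply: g0; lia.
- by apply: g1; lia.
- by apply: rule; lia.
Qed.

(** Lets each walk along a row below be reused as a walk along a column. *)
Lemma last_passage_tr :
  last_passage Y X (fun x y => M y x) (fun x y => g y x).
Proof.
case: lp => g0 g1 rule; split=> // a b aY bX.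
by rewrite rule // maxnC.
Qed.

Lemma last_passage_leS1 a b : a < X -> b <= Y -> g a b <= g a.+1 b.
Proof.
case: lp => g0 g1 rule aX; case: b => [|b] bY; first by rewrite !g0; lia.
by have := rule a b aX bY; lia.
Qed.

Lemma last_passage_leS2 a b : a <= X -> b < Y -> g a b <= g a b.+1.
Proof.
case: lp => g0 g1 rule; case: a => [|a] aX bY; first by rewrite !g1; lia.
by have := rule a b aX bY; lia.
Qed.

Lemma last_passage_mono x y x' y' :
  x <= x' <= X -> y <= y' <= Y -> g x y <= g x' y'.
Proof.
move=> /andP[xx' x'X] /andP[yy' y'Y]; apply: (@leq_trans (g x' y)).
  rewrite -(subnK xx') in x'X *.
  elim: (x' - x) x'X => [|n IHn] // nX; rewrite addSn.
  by apply: leq_trans (last_passage_leS1 _ _); [apply: IHn|..]; lia.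
rewrite -(subnK yy') in y'Y *.
elim: (y' - y) y'Y => [|n IHn] // nY; rewrite addSn.
by apply: leq_trans (last_passage_leS2 _ _); [apply: IHn|..]; lia.
Qed.

Lemma bump_gt0 a b :
  (0 < bump g a b) = (g a b < g a b.+1) && (g a b < g a.+1 b).
Proof. by rewrite /bump; lia. Qed.

(* A vertical edge along which g increases forces an increase along the next
   vertical edge to its right, unless g also increases along the edge below,
   which makes the cell in between a cell of the bumped filling. *)
Lemma ascent_right a b n : a + n < X -> b < Y -> 0 < M a b ->
  (exists2 x, a < x <= a + n & 0 < bump g x b) \/
  g (a + n).+1 b < g (a + n).+1 b.+1.
Proof.
case: lp => g0 g1 rule + bY Mab; elim: n => [|n IHn] nX.
  by right; rewrite addn0 in nX *; have := rule a b nX bY; lia.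
have {IHn} := IHn ltac:(lia).
case=> [[x xb Hx]|lt_v]; first by left; exists x => //; lia.
case: (ltnP (g (a + n).+1 b) (g (a + n).+2 b)) => lt_h.
  by left; exists (a + n).+1; [lia|rewrite bump_gt0 lt_v].
right; rewrite addnS in nX *.
have := rule _ _ nX bY; lia.
Qed.

(** Across a cell with [M = 0], an increase along the right edge comes from one along the left edge.
    There is none on the y-axis, so the walk to the left must meet a nonzero entry. *)
Lemma support_left x y : x <= X -> y < Y -> g x y < g x y.+1 ->
  exists2 a, a < x & 0 < M a y.
Proof.
case: lp => g0 g1 rule + yY; elim: x => [|x IHx] xX lt_g.
  by rewrite !g1 in lt_g; lia.
case: (posnP (M x y)) => [M0|]; last by exists x.
have le1 := @last_passage_leS1 x y xX ltac:(lia).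
have := rule x y xX yY; rewrite M0 => rl.
case: IHx => [||a ax Ma]; [lia|lia|exists a => //; lia].
Qed.

(** The walk of [support_left], stopped at column [x]. *)
Lemma ascent_left x y n : x + n < X -> y < Y ->
  g (x + n).+1 y < g (x + n).+1 y.+1 ->
  (exists2 a, x <= a <= x + n & 0 < M a y) \/
  g x.+1 y < g x.+1 y.+1 /\ M x y = 0.
Proof.
case: lp => g0 g1 rule + yY; elim: n => [|n IHn] nX lt_g.
  rewrite addn0 in nX lt_g *.
  case: (posnP (M x y)) => M0; first by right.
  by left; exists x; rewrite ?leqnn.
rewrite addnS in nX lt_g *.
case: (posnP (M (x + n).+1 y)) => M0; last by left; exists (x + n).+1; lia.
have le1 := @last_passage_leS1 _ y nX ltac:(lia).
have := rule _ _ nX yY; rewrite M0 => rl.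
case: IHn => [||[a ? ?]|?]; [lia|lia|left; exists a => //; lia|by right].
Qed.

End LastPassage.

(** * Se-chains of a filling and of the filling bumped out of it *)

Section Peel.

Variables (X Y : nat) (M g : nat -> nat -> nat).
Hypothesis lp : last_passage X Y M g.

(** Walk right from [(a, b)] and up from [(a', b')]. If neither walk meets a bumped cell, both
    arrive at the cell [(a', b)], whose left and bottom edges then both carry an increase. *)
Lemma bump_between a b a' b' : a < a' < X -> b' < b < Y ->
  0 < M a b -> 0 < M a' b' ->
  exists e, [/\ a < e.1 <= a', b' < e.2 <= b & 0 < bump g e.1 e.2].
Proof.
move=> aa' bb' Mab Mab'.
have := @ascent_right _ _ _ _ lp a b (a' - a.+1) ltac:(lia) ltac:(lia) Mab.
case=> [[x ? ?]|lt_v]; first by exists (x, b); split=> //=; lia.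
have := @ascent_right _ _ _ _ (last_passage_tr lp)
  b' a' (b - b'.+1) ltac:(lia) ltac:(lia) Mab'.
case=> [[y ? ?]|lt_h].
  exists (a', y); split=> /=; [lia|lia|].
  by rewrite /bump minnC.
have ea : (a + (a' - a.+1)).+1 = a' by lia.
have eb : (b' + (b - b'.+1)).+1 = b by lia.
rewrite ea in lt_v; rewrite eb in lt_h.
by exists (a', b); split=> /=; [lia|lia|rewrite bump_gt0 lt_v].
Qed.

(** Walk left from the lower cell and down from the upper one. If neither meets a nonzero entry, [g]
    increases along the right and top edges of the cell [(x1, y2)], which has entry 0; this
    contradicts the recursion there. *)
Lemma support_between x1 y1 x2 y2 : x1 < x2 < X -> y2 < y1 < Y ->
  0 < bump g x1 y1 -> 0 < bump g x2 y2 ->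
  exists c, [/\ x1 <= c.1 < x2, y2 <= c.2 < y1 & 0 < M c.1 c.2].
Proof.
rewrite !bump_gt0 => xx yy /andP[_ lt_h] /andP[lt_v _].
have ex : (x1 + (x2 - x1.+1)).+1 = x2 by lia.
have ey : (y2 + (y1 - y2.+1)).+1 = y1 by lia.
have := @ascent_left _ _ _ _ lp x1 y2 (x2 - x1.+1) ltac:(lia) ltac:(lia).
rewrite ex => /(_ lt_v).
case=> [[a ? ?]|[lt_v' M0]]; first by exists (a, y2); split=> //=; lia.
have := @ascent_left _ _ _ _ (last_passage_tr lp)
  y2 x1 (y1 - y2.+1) ltac:(lia) ltac:(lia).
rewrite ey => /(_ lt_h).
case=> [[b ? ?]|[lt_h' _]]; first by exists (x1, b); split=> //=; lia.
by case: lp => _ _ /(_ x1 y2 ltac:(lia) ltac:(lia)); lia.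
Qed.

Lemma has_se_bump k : has_se X Y M k.+1 -> has_se X Y (bump g) k.
Proof.
case=> -[|c s] // /andP[+ +] [<-] {k}.
(* The boxes given by [bump_between] for consecutive pairs are half-open, so the cells chosen in
   them form a chain. The fictitious head [(c.1, c.2.+1)] records that the next cell is strictly
   right of [c] and weakly below it. *)
suff: all (fun c => [&& c.1 < X, c.2 < Y & M c.1 c.2 != 0]) (c :: s) ->
  path se_rel c s -> exists s', [/\ size s' = size s,
    all (fun c => [&& c.1 < X, c.2 < Y & bump g c.1 c.2 != 0]) s' &
    path se_rel (c.1, c.2.+1) s'].
  move=> H Hall Hpath; have [s' [<- Ha Hp]] := H Hall Hpath.
  by exists s' => //; rewrite /se_chain_rect Ha; apply: path_sorted Hp.
elim: s c => [|c2 s IHs] c /=; first by exists [::].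
case/and3P=> /and3P[cX cY Mc] /and3P[c2X c2Y Mc2] Hall /andP[].
case/andP=> lt1 lt2 Hp.
have [|s' [sz Ha Hp']] := IHs c2 _ Hp; first by rewrite /= c2X c2Y Mc2.
have [||||e [e1 e2 be]] := @bump_between c.1 c.2 c2.1 c2.2; try lia.
exists (e :: s'); rewrite /= sz Ha; split=> //.
  by rewrite andbT; lia.
rewrite {1}/se_rel /=; apply/andP; split; first lia.
case: s' Hp' {sz Ha} => [|e' s'] //= /andP[+ ->].
by rewrite /se_rel /= andbT; lia.
Qed.

(** Besides the cells between consecutive bumped cells, there is one to the left of the first in its
    row and one below the last in its column. *)
Lemma has_se_unbump k : has_se X Y (bump g) k.+1 -> has_se X Y M k.+2.
Proof.
case=> -[|e s] // /andP[Hall Hpath] [<-] {k}.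
suff: exists c t, [/\ size t = size s,
    all (fun c => [&& c.1 < X, c.2 < Y & M c.1 c.2 != 0]) (c :: t),
    path se_rel c t, e.1 <= c.1 & c.2 < e.2].
  move=> [c [t [sz Ha Hp le1 le2]]].
  move: Hall => /= /andP[/and3P[eX eY]]; rewrite -lt0n bump_gt0.
  move=> /andP[lt_v _] _.
  have [||a ae Ma] := support_left lp _ _ lt_v; try lia.
  exists [:: (a, e.2), c & t]; last by rewrite /= sz.
  rewrite /se_chain_rect /=; move: Ha => /= ->; rewrite Hp /se_rel /=; lia.
elim: s e Hall Hpath => [|e2 s IHs] e /=.
  rewrite andbT => /and3P[eX eY]; rewrite -lt0n bump_gt0.
  move=> /andP[_ lt_h] _.
  have [||b be Mb] := support_left (last_passage_tr lp) _ _ lt_h; try lia.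
  by exists (e.1, b), [::]; split=> //=; lia.
case/and3P=> /and3P[eX eY Me] He2 Hall /andP[/andP[lt1 lt2] Hp].
have [|c [t [sz Ha Hpt le1 le2]]] := IHs e2 _ Hp; first by rewrite /= He2.
move: He2 => /and3P[? ? ?].
have [||||z [z1 z2 Mz]] := @support_between e.1 e.2 e2.1 e2.2; try lia.
exists z, (c :: t); split.
- by rewrite /= sz.
- by move: Ha => /= ->; lia.
- by rewrite /= Hpt /se_rel; lia.
- lia.
- lia.
Qed.

Lemma last_passage_le_cell c : c.1 < X -> c.2 < Y -> M c.1 c.2 <= g X Y.
Proof.
move=> cX cY; case: (lp) => _ _ rule.
have := rule _ _ cX cY.
have := @last_passage_mono _ _ _ _ lp c.1.+1 c.2.+1 X Y ltac:(lia) ltac:(lia).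
lia.
Qed.

Lemma has_se1 : has_se X Y M 1 <-> 0 < g X Y.
Proof.
case: (lp) => g0 g1 rule; split.
  case=> -[|c []] // /andP[/= /andP[/and3P[cX cY Mc] _] _] _.
  by have := last_passage_le_cell cX cY; lia.
suff H y : y <= Y -> 0 < g X y -> has_se X Y M 1 by apply: H.
elim: y => [|y IHy] yY; first by rewrite g0.
case: (ltnP (g X y) (g X y.+1)) => lt_v gy; last by apply: IHy; lia.
have [a aX Ma] := support_left lp (leqnn X) yY lt_v.
by exists [:: (a, y)] => //; rewrite /se_chain_rect /=; lia.
Qed.

(** The shift starts at length 2: the empty chain always exists in the bumped filling and says
    nothing about chains of length 1. *)
Lemma has_seS k : has_se X Y M k.+2 <-> has_se X Y (bump g) k.+1.
Proof. by split; [apply: has_se_bump|apply: has_se_unbump]. Qed.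

End Peel.

Lemma has_se_le X Y M k l : k <= l -> has_se X Y M l -> has_se X Y M k.
Proof.
move=> kl [s /andP[Ha Hs] sz]; exists (take k s); last by rewrite size_takel ?sz.
rewrite /se_chain_rect take_sorted // andbT.
by apply/allP=> c /mem_take; apply: (allP Ha).
Qed.

Lemma has_se_sub X Y X' Y' M k :
  X <= X' -> Y <= Y' -> has_se X Y M k -> has_se X' Y' M k.
Proof.
move=> XX' YY' [s /andP[Ha Hs] sz]; exists s => //; rewrite /se_chain_rect Hs andbT.
by apply: sub_all Ha => c /and3P[? ? ->]; lia.
Qed.

(** * Lengths of the partitions and se-chains *)

Definition inflow (d : nat) (f : nat -> nat -> nat)
    (G : nat -> nat -> nat -> nat) (i a b : nat) : nat :=
  if i == 1 then f a b + bump (G d) a b else bump (G i.-1) a b.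

Section Rows.

Variables (d X Y : nat) (f : nat -> nat -> nat) (G : nat -> nat -> nat -> nat).
Hypothesis d_gt0 : 0 < d.
Hypothesis lpG : forall i, 0 < i <= d -> last_passage X Y (inflow d f G i) (G i).

Lemma eq_has_se M N k : (forall a b, a < X -> b < Y -> M a b = N a b) ->
  has_se X Y M k -> has_se X Y N k.
Proof.
move=> MN [s /andP[Ha Hs] sz]; exists s => //; rewrite /se_chain_rect Hs andbT.
by apply: sub_all Ha => c /and3P[cX cY]; rewrite -MN // cX cY.
Qed.

Lemma last_passage_row1 :
  (forall a b, a < X -> b < Y -> bump (G d) a b = 0) ->
  last_passage X Y f (G 1).
Proof.
move=> b0; have [g0 g1 rule] := @lpG 1 d_gt0.
by split=> // a b aX bY; rewrite rule // /inflow eqxx b0 ?addn0.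
Qed.

(** Row 1 is driven by [f] alone. Peeling [i - 1] rows turns a chain of length [i] into a chain of
    length 1 in the inflow of row [i]. *)
Lemma has_se_row : (forall a b, a < X -> b < Y -> bump (G d) a b = 0) ->
  forall i, 0 < i <= d -> has_se X Y f i <-> 0 < G i X Y.
Proof.
move=> b0.
have E1 k : has_se X Y f k <-> has_se X Y (inflow d f G 1) k.
  by split; apply: eq_has_se => a b aX bY; rewrite /inflow eqxx b0 ?addn0.
have E j i : j < i <= d -> has_se X Y f i <-> has_se X Y (inflow d f G j.+1) (i - j).
  elim: j => [|j IHj] ji; first by rewrite subn0.
  have -> : i - j.+1 = (i - j.+2).+1 by lia.
  have := has_seS (@lpG j.+1 ltac:(lia)) (i - j.+2).
  have -> : (i - j.+2).+2 = i - j by lia.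
  by move=> <-; apply: IHj; lia.
move=> i /andP[i0 id]; have := E i.-1 i ltac:(lia).
rewrite prednK // => ->; have -> : i - i.-1 = 1 by lia.
by apply: has_se1; apply: lpG; lia.
Qed.

End Rows.

Lemma has_se_full d X Y f G : 0 < d ->
  (forall i, 0 < i <= d -> last_passage X Y (inflow d f G i) (G i)) ->
  0 < G d X Y -> has_se X Y f d.
Proof.
move=> d0 lpG.
have lpd := lpG d ltac:(lia); have [g0 g1 _] := lpd.
suff H x y : x <= X -> y <= Y -> 0 < G d x y -> has_se x y f d by apply: H.
elim: x y => [|a IHa] y; first by move=> _ yY; rewrite g1.
elim: y => [|b IHb] aX bY; first by rewrite g0.
case: (posnP (G d a b.+1)) => [G0|Gp] Gxy; last first.
  by apply: (@has_se_sub a b.+1) => //; apply: IHa; lia.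
case: (posnP (G d a.+1 b)) => [G1|Gp]; last first.
  by apply: (@has_se_sub a.+1 b) => //; apply: IHb; lia.
(* Here [G d] is positive at [(a.+1, b.+1)] but zero at its left and lower neighbours. The top-left
   corner of any cell of this rectangle lies below [(a, b.+1)], so by monotonicity row [d] bumps
   nothing out. *)
apply/(has_se_row d0 (G := G)) => //; last lia.
  by move=> i id; apply: (last_passage_sub (lpG i id)).
move=> a' b' aa bb; rewrite /bump.
have := @last_passage_mono _ _ _ _ lpd a' b'.+1 a b.+1 ltac:(lia) ltac:(lia).
lia.
Qed.

(** * NE-chains in a rectangle *)

Lemma ne_rel_trans : transitive ne_rel.
Proof. move=> [x1 y1] [x2 y2] [x3 y3]; rewrite /ne_rel /= !xpair_eqE; lia. Qed.

Definition below (x y : nat) (c : nat * nat) : bool := (c.1 < x) && (c.2 < y).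

(** The cell before [(a, b)] differs from it, so it is strictly to the left or strictly below, and
    all earlier cells inherit this. The two rectangles are those in the last passage recursion. *)
Lemma sorted_ne_rcons s a b : sorted ne_rel (rcons s (a, b)) =
  sorted ne_rel s && (all (below a b.+1) s || all (below a.+1 b) s).
Proof.
rewrite !(sorted_pairwise ne_rel_trans) pairwise_rcons andbC.
case pw: (pairwise _ _) => //=; apply/idP/orP.
  case: (lastP s) pw => [|t [u v]]; first by left.
  rewrite pairwise_rcons !all_rcons => /andP[Ht _] /andP[Huv _].
  have : (u < a) && (v < b.+1) || (u < a.+1) && (v < b).
    by move: Huv; rewrite /ne_rel /= xpair_eqE; lia.
  case/orP=> lt_uv; [left|right]; rewrite /below /= lt_uv /=;
    apply: sub_all Ht => c; rewrite /ne_rel /=; lia.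
by case=> Ha; apply: sub_all Ha => -[u v];
  rewrite /below /ne_rel /= xpair_eqE; lia.
Qed.

Lemma ne_length_rcons f s c : ne_length f (rcons s c) = ne_length f s + f c.1 c.2.
Proof. by rewrite /ne_length -cats1 big_cat big_seq1. Qed.

Section NEChains.

Variables (X Y : nat) (f g : nat -> nat -> nat).
Hypothesis lp : last_passage X Y f g.

Lemma ne_length_le s : sorted ne_rel s -> all (below X Y) s -> ne_length f s <= g X Y.
Proof.
suff H x y : x <= X -> y <= Y -> sorted ne_rel s -> all (below x y) s ->
  ne_length f s <= g x y by apply: H.
elim/last_ind: s x y => [|s [a b] IHs] x y xX yY; first by rewrite /ne_length big_nil.
rewrite sorted_ne_rcons all_rcons ne_length_rcons /below /=.
move=> /andP[Hs Hab] /andP[/andP[ax by_] _].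
apply: (@leq_trans (g a.+1 b.+1)); last by apply: (last_passage_mono lp); lia.
case: (lp) => _ _ -> //; [|lia|lia].
rewrite addnC leq_add2l leq_max.
by apply/orP; case/orP: Hab => Ha; [left|right]; apply: IHs => //; lia.
Qed.

Lemma ne_length_attained : exists s, [/\ sorted ne_rel s,
  all (fun c => below X Y c && (f c.1 c.2 != 0)) s & ne_length f s = g X Y].
Proof.
case: (lp) => g0 g1 rule.
suff H x y : x <= X -> y <= Y -> exists s, [/\ sorted ne_rel s,
  all (fun c => below x y c && (f c.1 c.2 != 0)) s & ne_length f s = g x y].
  by apply: H.
elim: x y => [|a IHa] y.
  by move=> _ yY; exists [::]; rewrite g1 // /ne_length big_nil.
elim: y => [|b IHb] aX bY.
  by exists [::]; rewrite g0 // /ne_length big_nil.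
(* Remembering which smaller rectangle contains [s] is what allows [(a, b)] to be appended when its
   entry is nonzero. *)
have [s [Hs Hb Hf Hg]] : exists s, [/\ sorted ne_rel s,
    all (below a b.+1) s || all (below a.+1 b) s,
    all (fun c => below a.+1 b.+1 c && (f c.1 c.2 != 0)) s &
    ne_length f s = maxn (g a b.+1) (g a.+1 b)].
  case: (leqP (g a b.+1) (g a.+1 b)) => le_g.
    have [|s [Hs Ha Hg]] := IHb aX; first lia.
    exists s; split=> //.
    - by apply/orP; right; apply: sub_all Ha => c /andP[].
    - by apply: sub_all Ha => c; rewrite /below; lia.
  have [||s [Hs Ha Hg]] := IHa b.+1; try lia.
  exists s; split=> //.
  - by apply/orP; left; apply: sub_all Ha => c /andP[].
  - by apply: sub_all Ha => c; rewrite /below; lia.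
rewrite rule //; case: (posnP (f a b)) => [->|fab]; first by exists s; split.
exists (rcons s (a, b)); split.
- by rewrite sorted_ne_rcons Hs.
- by rewrite all_rcons Hf /below /=; lia.
- by rewrite ne_length_rcons Hg /= addnC.
Qed.

End NEChains.

(** * The outer boundary *)

Lemma nth_partition_le l i j : is_partition l -> i <= j -> nth 0 l j <= nth 0 l i.
Proof.
move=> /andP[sl _] ij; case: (ltnP j (size l)) => jl; last by rewrite nth_default.
have geq_trans : transitive geq by move=> x y z /= yx xz; apply: leq_trans yx.
by apply: (sorted_leq_nth geq_trans leqnn 0 sl); rewrite ?inE //; lia.
Qed.

Lemma nth_partition_gt0 l i : is_partition l -> (0 < nth 0 l i) = (i < size l).
Proof.
move=> /andP[_ pl]; case: (ltnP i (size l)) => il; last by rewrite nth_default.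
by apply: (allP pl); apply: mem_nth.
Qed.

Lemma is_partition_behead r l : is_partition (r :: l) -> is_partition l.
Proof. by case/andP=> /= /path_sorted sl /andP[_ pl]; rewrite /is_partition sl. Qed.

(** Keeping each step with its starting point makes boundary edges a matter of membership instead of
    positions in a word. *)
Fixpoint steps (p : nat * nat) (w : seq bool) : seq ((nat * nat) * bool) :=
  if w is b :: w' then (p, b) :: steps (bstep p b) w' else [::].

Lemma size_steps p w : size (steps p w) = size w.
Proof. by elim: w p => //= b w IHw p; rewrite IHw. Qed.

Lemma size_bpoints p w : size (bpoints p w) = (size w).+1.
Proof. by elim: w p => //= b w IHw p; rewrite IHw. Qed.

Lemma nth_steps e p w i : i < size w ->
  nth e (steps p w) i = (nth (0, 0) (bpoints p w) i, nth false w i).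
Proof. by elim: w p i => // b w IHw p [|i] //= iw; rewrite IHw. Qed.

Lemma nth_bpointsS p w i : i < size w ->
  nth (0, 0) (bpoints p w) i.+1 = bstep (nth (0, 0) (bpoints p w) i) (nth false w i).
Proof. by elim: w p i => // b w IHw p [|i] //= iw; [case: w IHw {iw}|rewrite -IHw]. Qed.

Lemma bpoints_left r y k w : bpoints (r, y) (nseq k false ++ w) =
  [seq (r - i, y) | i <- iota 0 k] ++ bpoints (r - k, y) w.
Proof.
elim: k r => [|k IHk] r /=; first by rewrite subn0.
rewrite /bstep /= IHk subn0 (iotaDl 1 0) -map_comp.
by congr (_ :: _ ++ bpoints (_, _) _); [apply: eq_map => i /=; congr (_, _)|]; lia.
Qed.

Lemma steps_left r y k w : steps (r, y) (nseq k false ++ w) =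
  [seq ((r - i, y), false) | i <- iota 0 k] ++ steps (r - k, y) w.
Proof.
elim: k r => [|k IHk] r /=; first by rewrite subn0.
rewrite /bstep /= IHk subn0 (iotaDl 1 0) -map_comp.
by congr (_ :: _ ++ steps (_, _) _); [apply: eq_map => i /=; congr (_, _, _)|]; lia.
Qed.

Lemma last_bpoints_bsteps sh y0 p0 : is_partition sh ->
  last p0 (bpoints (head 0 sh, y0) (bsteps sh)) = (0, y0 + size sh).
Proof.
elim: sh y0 p0 => [|r t IHt] y0 p0 psh /=; first by rewrite addn0.
have le_tr := nth_partition_le psh (leq0n 1); rewrite /= nth0 in le_tr.
rewrite /bstep /= bpoints_left last_cat subKn // IHt ?addSnnS //.
exact: is_partition_behead psh.
Qed.

(** A left step from [(x, y)] runs along the top of a cell with no cell of the diagram above it; the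
    default 0 of [nth] covers the top row. The starting height [y0] is free for the induction. *)
Lemma mem_steps_bsteps sh y0 x y b : is_partition sh ->
  (((x, y), b) \in steps (head 0 sh, y0) (bsteps sh)) =
  if b then (y0 <= y < y0 + size sh) && (x == nth 0 sh (y - y0))
  else (y0 < y <= y0 + size sh) &&
       (nth 0 sh (y - y0) < x <= nth 0 sh (y - y0).-1).
Proof.
elim: sh y0 => [|r t IHt] y0 psh; first by rewrite in_nil !nth_nil /=; case: b; lia.
have le_tr := nth_partition_le psh (leq0n 1); rewrite /= nth0 in le_tr.
rewrite [bsteps _]/= [head _ _]/= [steps _ _]/= /bstep /= steps_left subKn //.
rewrite in_cons mem_cat {}IHt ?(is_partition_behead psh) // !xpair_eqE.
have -> : ((x, y, b) \in [seq (r - i, y0.+1, false) | i <- iota 0 (r - head 0 t)])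
    = [&& ~~ b, y == y0.+1 & head 0 t < x <= r].
  apply/mapP/and3P.
    by case=> i; rewrite mem_iota => ? [-> -> ->]; split=> //; lia.
  case=> /negbTE -> /eqP -> ?; exists (r - x); first by rewrite mem_iota; lia.
  by congr (_, _, _); lia.
case: (ltngtP y y0) => [lt_y|lt_y|->].
- by case: b; lia.
- have -> : y - y0 = (y - y0.+1).+1 by lia.
  case: (ltngtP y y0.+1) => lt_y'; first lia; last first.
    by rewrite lt_y' subnn /= nth0; case: b; lia.
  have -> : y - y0.+1 = (y - y0.+1).-1.+1 by lia.
  by rewrite /=; case: b; lia.
- by rewrite subnn /=; case: b; lia.
Qed.

Lemma MCW_steps d (Q : nat * nat -> seq nat) p w :
  MCW d w (map Q (bpoints p w)) =
  \max_(e <- steps p w)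
    (if e.2 then MCW2 d (Q e.1) (Q (bstep e.1 true))
     else MCW2 d (Q (bstep e.1 false)) (Q e.1)).
Proof.
rewrite (big_nth ((0, 0), false)) big_mkord size_steps /MCW.
apply: eq_bigr => -[i iw] _ /=; rewrite nth_steps //=.
rewrite !(nth_map (0, 0)) ?size_bpoints ?ltnS //; last lia.
by rewrite nth_bpointsS //; case: (nth false w i).
Qed.

(** * Growth diagrams on a Young diagram *)

Section Diagram.

Variables (d : nat) (sh : seq nat) (f : nat -> nat -> nat) (P : nat -> nat -> seq nat).
Hypotheses (d_gt0 : 0 < d) (psh : is_partition sh) (gdP : growth_diagram d sh f P).

Let G i x y := part (P x y) i.

Lemma in_F_le a b a' b' : a' <= a -> b' <= b -> in_F sh a b -> in_F sh a' b'.
Proof.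
rewrite /in_F => aa bb /andP[? ?]; have := nth_partition_le psh bb; lia.
Qed.

Lemma lattice_pt_in_F X Y a b : lattice_pt sh X Y -> a < X -> b < Y -> in_F sh a b.
Proof.
case=> [[-> _]|[a0 [b0 [F0 ? ?]]]] // aX bY; apply: in_F_le F0; lia.
Qed.

Lemma lattice_pt_le X Y x y : x <= X -> y <= Y -> lattice_pt sh X Y -> lattice_pt sh x y.
Proof.
move=> xX yY [[X0 Y0]|[a [b [F0 ? ?]]]]; first by left; lia.
by right; exists x.-1, y.-1; split; [apply: in_F_le F0|..]; lia.
Qed.

Lemma in_F_corner a b x y :
  in_F sh a b -> a <= x <= a.+1 -> b <= y <= b.+1 -> lattice_pt sh x y.
Proof. by move=> ? ? ?; right; exists a, b. Qed.

Lemma growth_axis x y : lattice_pt sh x y -> x = 0 \/ y = 0 -> P x y = [::].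
Proof. by case: gdP => H _; apply: H. Qed.

Lemma growth_dpart x y : lattice_pt sh x y -> is_dpart d (P x y).
Proof.
move=> Lxy; case: (Lxy) => [[x0 _]|[a [b [Fab xa yb]]]].
  by rewrite growth_axis //; left.
have [[? [? [? ?]]] _ _ _ _] := (gdP.2 a b Fab).
have [->|->] : x = a \/ x = a.+1 by lia.
  by have [->|->] : y = b \/ y = b.+1 by lia.
by have [->|->] : y = b \/ y = b.+1 by lia.
Qed.

(** Interlacing gives [kappa_j <= min(mu_j, nu_j)], so moving [kappa_j] to the other side of a
    growth rule agrees with the natural subtraction in [bump]. *)
Lemma growth_lp X Y i : lattice_pt sh X Y -> 0 < i <= d ->
  last_passage X Y (inflow d f G i) (G i).
Proof.
move=> LXY id; split=> [x xX|y yY|a b aX bY].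
- rewrite /G growth_axis; [by rewrite /part nth_nil| |by right].
  exact: lattice_pt_le LXY.
- rewrite /G growth_axis; [by rewrite /part nth_nil| |by left].
  exact: lattice_pt_le LXY.
have [_ [[km kn] _] _ r1 ri] := gdP.2 a b (lattice_pt_in_F LXY aX bY).
rewrite /inflow /bump /G; case: eqP => [->|i1].
  by have := km d d_gt0; have := kn d d_gt0; lia.
by have := km i.-1 ltac:(lia); have := kn i.-1 ltac:(lia);
  have := ri i ltac:(lia); lia.
Qed.

Lemma size_growth X Y K : lattice_pt sh X Y ->
  is_max_over (fun s => se_chain_rect X Y f s) size K ->
  size (P X Y) = minn d K.
Proof.
move=> LXY [[s [Hs sK]] maxK].
have lpG i : 0 < i <= d -> last_passage X Y (inflow d f G i) (G i) by apply: growth_lp.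
have /andP[pP szP] := growth_dpart LXY.
have Gi i : 0 < i -> (0 < G i X Y) = (i <= size (P X Y)).
  by move=> i0; rewrite /G /part nth_partition_gt0 // prednK.
have seK k : has_se X Y f k -> k <= K by case=> t Ht <-; apply: maxK.
(* If part [d] is positive, the length is [d] and a chain of length [d] exists. Otherwise part [d]
   vanishes on the whole rectangle and nothing re-enters row 1. *)
case: (posnP (G d X Y)) => [Gd0|Gd]; last first.
  have := seK _ (has_se_full d_gt0 lpG Gd).
  by move: Gd; rewrite Gi //; lia.
have row : forall i, 0 < i <= d -> has_se X Y f i <-> 0 < G i X Y.
  apply: has_se_row => // a b aX bY; rewrite /bump.
  have := @last_passage_mono _ _ _ _ (lpG d ltac:(lia)) a b.+1 X Y ltac:(lia) ltac:(lia).
  lia.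
have lt_d : size (P X Y) < d by have := Gi d d_gt0; lia.
have le_szK : size (P X Y) <= K.
  case: (posnP (size (P X Y))) => [->|sz0] //.
  by apply/seK/row; [lia|rewrite Gi].
suff : K <= size (P X Y) by lia.
rewrite leqNgt; apply/negP => lt_szK.
have : has_se X Y f (size (P X Y)).+1 by apply: has_se_le lt_szK _; exists s.
by move/row => /(_ ltac:(lia)); rewrite Gi // ltnn.
Qed.

(* Weights of the unit edges starting at (a, b), to the right and upwards. *)
Let top a b := MCW2 d (P a b) (P a.+1 b).
Let side a b := MCW2 d (P a b) (P a b.+1).

(** The left side is [rho_1 - min(mu_d, nu_d)] and the last maximum is [max(mu_1, nu_1) - kappa_d],
    so this is the first growth rule rearranged. *)
Lemma cell_width a b : in_F sh a b ->
  maxn (top a b.+1) (side a.+1 b) = f a b + maxn (top a b) (side a b).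
Proof.
move=> Fab; have [[dk _] [[km kn] _] m0 r1 _] := gdP.2 a b Fab.
have /andP[pk _] := dk.
have := nth_partition_le pk (leq0n d.-1); rewrite -/(part (P a b) 1) -/(part (P a b) d).
have := km 1 isT; have := kn 1 isT.
by rewrite /top /side /MCW2; case/orP: m0 => /eqP; lia.
Qed.

(** The rectangle exceeds that of [(a, b)] by at most one unit in one direction only, so each of its
    cells has its top-left or bottom-right corner where part [d] is zero. That makes the minimum in
    [bump] vanish. *)
Lemma growth_lp_row1 X Y a b : lattice_pt sh a b -> lattice_pt sh X Y ->
  (X <= a /\ Y <= b.+1) \/ (X <= a.+1 /\ Y <= b) ->
  part (P a b) d = 0 -> last_passage X Y f (G 1).
Proof.
move=> Lab LXY le_XY Gd0.
have lpG i : 0 < i <= d -> last_passage X Y (inflow d f G i) (G i) by apply: growth_lp.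
apply: last_passage_row1 d_gt0 lpG _ => a' b' aX bY; rewrite /bump.
have lpd := growth_lp Lab (_ : 0 < d <= d); rewrite d_gt0 leqnn in lpd.
have mono x y : x <= a -> y <= b -> G d x y = 0.
  move=> xa yb; apply/eqP; rewrite -leqn0 -Gd0.
  by apply: (last_passage_mono (lpd isT)); lia.
by case: le_XY => le_XY; [rewrite (mono a'.+1 b')|rewrite (mono a' b'.+1)]; lia.
Qed.

Lemma cell_chain a b : in_F sh a b -> 0 < f a b ->
  last_passage a b.+1 f (G 1) /\ last_passage a.+1 b f (G 1) /\
  maxn (top a b.+1) (side a.+1 b) = f a b + maxn (G 1 a b.+1) (G 1 a.+1 b).
Proof.
move=> Fab f0; have [_ _ m0 _ _] := gdP.2 a b Fab.
have k0 : part (P a b) d = 0 by move: m0; lia.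
have L x y : a <= x <= a.+1 -> b <= y <= b.+1 -> lattice_pt sh x y.
  exact: in_F_corner.
split; first by apply: (@growth_lp_row1 _ _ a b) => //; try apply: L; lia.
split; first by apply: (@growth_lp_row1 _ _ a b) => //; try apply: L; lia.
by rewrite cell_width // /top /side /MCW2 k0 !subn0 maxnC.
Qed.

Lemma ne_chain_le_width s a b : ne_chain sh f (rcons s (a, b)) ->
  ne_length f (rcons s (a, b)) <= maxn (top a b.+1) (side a.+1 b).
Proof.
rewrite /ne_chain all_rcons sorted_ne_rcons ne_length_rcons /=.
move=> /andP[/andP[/andP[Fab f0] _] /andP[Hs Hb]].
have [|lp1 [lp2 ->]] := cell_chain Fab _; first by rewrite lt0n.
rewrite addnC leq_add2l leq_max.
by apply/orP; case/orP: Hb => Hb; [left|right]; apply: ne_length_le.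
Qed.

Lemma ne_chain_width a b : in_F sh a b -> 0 < f a b ->
  exists2 s, ne_chain sh f s & ne_length f s = maxn (top a b.+1) (side a.+1 b).
Proof.
move=> Fab f0; have [lp1 [lp2 ->]] := cell_chain Fab f0.
have [s [Hs Hb Hf Hg]] : exists s, [/\ sorted ne_rel s,
    all (below a b.+1) s || all (below a.+1 b) s,
    all (fun c => f c.1 c.2 != 0) s &
    ne_length f s = maxn (G 1 a b.+1) (G 1 a.+1 b)].
  case: (leqP (G 1 a b.+1) (G 1 a.+1 b)) => _.
    have [s [Hs Ha Hg]] := ne_length_attained lp2; exists s; split=> //.
      by apply/orP; right; apply: sub_all Ha => c /andP[].
    by apply: sub_all Ha => c /andP[].
  have [s [Hs Ha Hg]] := ne_length_attained lp1; exists s; split=> //.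
    by apply/orP; left; apply: sub_all Ha => c /andP[].
  by apply: sub_all Ha => c /andP[].
exists (rcons s (a, b)); last by rewrite ne_length_rcons Hg addnC.
rewrite /ne_chain sorted_ne_rcons Hs Hb all_rcons /= Fab -lt0n f0 /= andbT.
rewrite all_predI Hf andbT.
by case/orP: Hb => Hb; apply: sub_all Hb => c /andP[c1 c2];
  apply: in_F_le Fab; lia.
Qed.

(** A nonzero entry gives a chain of exactly this weight. With entry 0 the maximum passes to the
    bottom and left edges, which belong to earlier cells or lie on an axis and have weight 0. *)
Lemma cell_width_le L a b : (forall s, ne_chain sh f s -> ne_length f s <= L) ->
  in_F sh a b -> maxn (top a b.+1) (side a.+1 b) <= L.
Proof.
move=> maxL; have [n] := ubnP (a + b); elim: n a b => // n IHn a b lt_n Fab.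
case: (posnP (f a b)) => f0; last first.
  by have [s Hs <-] := ne_chain_width Fab f0; apply: maxL.
rewrite cell_width // f0 add0n geq_max; apply/andP; split.
  case: b => [|b] in lt_n Fab {f0} *.
    rewrite /top /MCW2 (@growth_axis a.+1 0) ?/part ?nth_nil //; last by right.
    by apply: (in_F_corner Fab); lia.
  have Fab' : in_F sh a b by apply: in_F_le Fab.
  by apply: leq_trans (IHn a b _ Fab'); [apply: leq_maxl|lia].
case: a => [|a] in lt_n Fab {f0} *.
  rewrite /side /MCW2 (@growth_axis 0 b.+1) ?/part ?nth_nil //; last by left.
  by apply: (in_F_corner Fab); lia.
have Fab' : in_F sh a b by apply: in_F_le Fab.
by apply: leq_trans (IHn a b _ Fab'); [apply: leq_maxr|lia].
Qed.

(** * Edge weights along the outer boundary *)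

Let bd := steps (head 0 sh, 0) (bsteps sh).

Lemma mem_boundary_up x y : ((x, y), true) \in bd ->
  exists2 a, x = a.+1 & in_F sh a y.
Proof.
rewrite /bd mem_steps_bsteps // subn0 add0n => /andP[/= yS /eqP ->].
have := nth_partition_gt0 y psh; rewrite yS => x0.
by exists (nth 0 sh y).-1; rewrite /in_F; lia.
Qed.

Lemma mem_boundary_left x y : ((x, y), false) \in bd ->
  exists a b, [/\ x = a.+1, y = b.+1 & in_F sh a b].
Proof.
rewrite /bd mem_steps_bsteps // subn0 add0n => ?.
by exists x.-1, y.-1; rewrite /in_F; split; lia.
Qed.

Lemma boundary_up a b : in_F sh a b -> ~~ in_F sh a.+1 b -> ((a.+1, b), true) \in bd.
Proof. by rewrite /bd mem_steps_bsteps // subn0 /in_F; lia. Qed.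

Lemma boundary_left a b : in_F sh a b -> ~~ in_F sh a b.+1 ->
  ((a.+1, b.+1), false) \in bd.
Proof.
rewrite /bd mem_steps_bsteps // subn0 /in_F /=.
by case: (ltnP b.+1 (size sh)) => ?; [|rewrite (@nth_default _ _ _ b.+1)]; lia.
Qed.

(* A left step is recorded with its right endpoint. *)
Let width (e : (nat * nat) * bool) :=
  if e.2 then side e.1.1 e.1.2 else top e.1.1.-1 e.1.2.

(** The top and right edges either lie on the boundary or are the bottom and left edges of the next
    cells, whose maxima are at least as large. *)
Lemma cell_width_boundary a b : in_F sh a b ->
  maxn (top a b.+1) (side a.+1 b) <= \max_(e <- bd) width e.
Proof.
have [n] := ubnP (head 0 sh + size sh - (a + b)).
elim: n a b => // n IHn a b lt_n Fab.
have lt_ab : a < head 0 sh /\ b < size sh.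
  by rewrite -nth0; have := nth_partition_le psh (leq0n b); move: Fab; rewrite /in_F; lia.
rewrite geq_max; apply/andP; split.
  case: (boolP (in_F sh a b.+1)) => Fab'.
    apply: leq_trans (IHn a b.+1 _ Fab'); last lia.
    by rewrite cell_width // (leq_trans (leq_maxl _ _) (leq_addl _ _)).
  exact: (@leq_bigmax_seq _ bd xpredT width _ (boundary_left Fab Fab') isT).
case: (boolP (in_F sh a.+1 b)) => Fab'.
  apply: leq_trans (IHn a.+1 b _ Fab'); last lia.
  by rewrite cell_width // (leq_trans (leq_maxr _ _) (leq_addl _ _)).
exact: (@leq_bigmax_seq _ bd xpredT width _ (boundary_up Fab Fab') isT).
Qed.

Let Q (p : nat * nat) := P p.1 p.2.

Lemma MCW_boundary :
  MCW d (boundary_word sh) (map Q (boundary_points sh)) = \max_(e <- bd) width e.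
Proof.
rewrite MCW_steps !big_seq; apply: eq_bigr => -[[x y] []] //.
by move=> /mem_boundary_left[a [b [-> -> _]]].
Qed.

(** For one inequality, carry the weight at the last cell of a longest chain outwards to the
    boundary. For the other, each boundary edge is the top or right edge of a cell, where
    [cell_width_le] applies. *)
Lemma ne_chain_MCW L : is_max_over (fun s => ne_chain sh f s) (ne_length f) L ->
  L = MCW d (boundary_word sh) (map Q (boundary_points sh)).
Proof.
move=> [[s [Hs <-]] maxL]; rewrite MCW_boundary.
apply/eqP; rewrite eqn_leq; apply/andP; split.
  case/lastP: s Hs {maxL} => [|s [a b]] Hs; first by rewrite /ne_length big_nil.
  apply: leq_trans (ne_chain_le_width Hs) (cell_width_boundary _).
  by move: Hs; rewrite /ne_chain all_rcons => /andP[/andP[/andP[]]].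
apply/bigmax_leqP_seq => -[[x y] []] + _.
  move=> /mem_boundary_up[a -> Fab].
  by apply: leq_trans (cell_width_le maxL Fab); apply: leq_maxr.
move=> /mem_boundary_left[a [b [-> -> Fab]]].
by apply: leq_trans (cell_width_le maxL Fab); apply: leq_maxl.
Qed.

Lemma osc_boundary :
  osc_tableau d (boundary_word sh) (map Q (boundary_points sh)).
Proof.
pose w := boundary_word sh.
have szT : size (map Q (boundary_points sh)) = (size w).+1.
  by rewrite size_map size_bpoints.
have TE i : i <= size w -> nth [::] (map Q (boundary_points sh)) i
    = Q (nth (0, 0) (boundary_points sh) i).
  by move=> iw; rewrite (nth_map (0, 0)) // size_bpoints.
have stepE i : i < size w ->
    (nth (0, 0) (boundary_points sh) i, nth false w i) \in bd.
  by move=> iw; rewrite -(nth_steps ((0, 0), false)) // mem_nth // size_steps.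
have last_nil : nth [::] (map Q (boundary_points sh)) (size w) = [::].
  rewrite TE //; have := last_bpoints_bsteps 0 (0, 0) psh.
  rewrite -nth_last size_bpoints /boundary_points => ->; rewrite /Q /=.
  apply: growth_axis; last by left.
  case: (posnP (size sh)) => [->|sz0]; first by left.
  have := nth_partition_gt0 (size sh).-1 psh; rewrite ltn_predL sz0 => x0.
  by apply: (@in_F_corner 0 (size sh).-1); rewrite /in_F; lia.
split=> //; split; [|split; [|split]].
- rewrite TE // /boundary_points; have -> p v : nth (0, 0) (bpoints p v) 0 = p by case: v.
  rewrite /Q /=; apply: growth_axis; last by right.
  case: (posnP (head 0 sh)) => [->|h0]; first by left.
  apply: (@in_F_corner (head 0 sh).-1 0); [|lia|lia].
  by case: sh h0 => //= r t; rewrite /in_F /=; lia.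
- by rewrite -nth_last szT.
(* The final point starts no step, so it is handled apart from the others. *)
- move=> i; rewrite szT ltnS leq_eqVlt => /predU1P[->|iw].
    by rewrite last_nil.
  rewrite TE 1?ltnW //; have := stepE i iw; rewrite /Q.
  case: (nth (0, 0) _ i) => x y; case: (nth false w i) => /=.
    by move=> /mem_boundary_up[a -> Fab]; apply/growth_dpart/(in_F_corner Fab); lia.
  move=> /mem_boundary_left[a [b [-> -> Fab]]].
  by apply/growth_dpart/(in_F_corner Fab); lia.
move=> i iw; have iw' := ltnW iw; rewrite !TE // /boundary_points nth_bpointsS //; have := stepE i iw; rewrite /Q.
case: (nth (0, 0) _ i) => x y; case: (nth false w i) => /=.
  by move=> /mem_boundary_up[a -> Fab]; have [_ [_ []]] := gdP.2 a y Fab.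
by move=> /mem_boundary_left[a [b [-> -> Fab]]]; have [_ [_ []]] := gdP.2 a b Fab.
Qed.

End Diagram.

Theorem theorem3p6 (d : nat) (sh : seq nat) (f : nat -> nat -> nat)
    (P : nat -> nat -> seq nat) :
  0 < d -> is_partition sh -> growth_diagram d sh f P ->
  (forall x y K, lattice_pt sh x y ->
     is_max_over (fun s => se_chain_rect x y f s) size K ->
     size (P x y) = minn d K) /\
  (let w := boundary_word sh in
   let T := map (fun p => P p.1 p.2) (boundary_points sh) in
   osc_tableau d w T /\
   forall L, is_max_over (fun s => ne_chain sh f s) (ne_length f) L ->
     L = MCW d w T).
Proof.
move=> d0 psh gdP; split=> [x y K|w T]; first exact: size_growth.
by split=> [|L]; [apply: osc_boundary gdP|apply: ne_chain_MCW].
Qed.
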